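(* Let $u:A\rightarrow A'$ be a morphism of algebras in $\mathcal{V}$ that lifts the Boolean congruences, and let $\Omega'$ be a countable orthogonal subset of $B(Con(A'))$. Then there exists a countable orthogonal subset $\Omega$ of $B(Con(A))$ such that $u$ lifts $\Omega'$ to $\Omega$.
   Context: $\mathcal{V}$ is a congruence modular, semidegenerate variety (no nontrivial algebra has a one-element subalgebra) of finite signature, such that for every $B\in\mathcal{V}$ the set $K(B)$ of compact congruences is closed under the Freese–McKenzie commutator $[\cdot,\cdot]$. $Con(B)$ is the congruence lattice with bounds $\Delta_B,\nabla_B$; $B(Con(B))$ is the Boolean algebra of complemented elements of $Con(B)$. For a morphism $u:A\to A'$ and $\alpha\in Con(A)$, $u^{\bullet}(\alpha)$ is the congruence of $A'$ generated by $\{(u(a),u(b)):(a,b)\in\alpha\}$; $u^{\bullet}$ restricts to a Boolean morphism $B(Con(A))\to B(Con(A'))$. For $\Omega'\subseteq Con(A')$ and $\Omega\subseteq Con(A)$, $u$ lifts $\Omega'$ to $\Omega$ if $\Omega'=\{u^{\bullet}(\alpha):\alpha\in\Omega\}$; $u$ lifts the Boolean congruences if it lifts $B(Con(A'))$ to $B(Con(A))$. A subset $\Omega$ of $B(Con(A))$ is orthogonal if $\alpha\cap\beta=\Delta_A$ (equivalently $[\alpha,\beta]=\Delta_A$) for all distinct $\alpha,\beta\in\Omega$. *)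

(* Defs.v *)
From mathcomp Require Import all_boot.
Set Implicit Arguments. Unset Strict Implicit. Unset Printing Implicit Defensive.

Record signature := Signature { op : Type; arity : op -> nat }.

Definition finite_signature (S : signature) : Prop :=
  exists (n : nat) (f : 'I_n -> op S), forall o, exists i, f i = o.

Record algebra (S : signature) := Algebra {
  carrier :> Type;
  interp : forall o : op S, ('I_(arity o) -> carrier) -> carrier }.
Arguments interp {S a} o _.

Inductive term (S : signature) (X : Type) : Type :=
| Var : X -> term S X
| App : forall o : op S, ('I_(arity o) -> term S X) -> term S X.

Fixpoint eval (S : signature) (A : algebra S) (X : Type) (v : X -> A)
  (t : term S X) : A :=
  match t with
  | Var x => v x
  | App o ts => interp o (fun i => eval v (ts i))
  end.

(* A variety is given by a set E of identities (Birkhoff). *)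
Definition in_var (S : signature) (E : term S nat -> term S nat -> Prop)
  (A : algebra S) : Prop :=
  forall s t, E s t -> forall v : nat -> A, eval v s = eval v t.

Definition is_hom (S : signature) (A B : algebra S) (u : A -> B) : Prop :=
  forall (o : op S) (args : 'I_(arity o) -> A),
    u (interp o args) = interp o (fun i => u (args i)).

Definition crel (T : Type) := T -> T -> Prop.

Definition is_cong (S : signature) (A : algebra S) (th : crel A) : Prop :=
  [/\ (forall x, th x x), (forall x y, th x y -> th y x),
      (forall x y z, th x y -> th y z -> th x z) &
      (forall (o : op S) (a b : 'I_(arity o) -> A),
          (forall i, th (a i) (b i)) -> th (interp o a) (interp o b))].

Definition rle (T : Type) (a b : crel T) : Prop := forall x y, a x y -> b x y.

Definition Delta (T : Type) : crel T := fun x y => x = y.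
Definition Nabla (T : Type) : crel T := fun _ _ => True.

Definition cgen (S : signature) (A : algebra S) (R : crel A) : crel A :=
  fun x y => forall th, is_cong th -> rle R th -> th x y.

Definition cmeet (T : Type) (a b : crel T) : crel T := fun x y => a x y /\ b x y.
Definition cjoin (S : signature) (A : algebra S) (a b : crel A) : crel A :=
  cgen (fun x y => a x y \/ b x y).
Definition cbigjoin (S : signature) (A : algebra S) (F : crel A -> Prop) : crel A :=
  cgen (fun x y => exists th, F th /\ th x y).

Definition boolean_cong (S : signature) (A : algebra S) (a : crel A) : Prop :=
  is_cong a /\ exists b, is_cong b /\ cmeet a b = @Delta A /\ cjoin a b = @Nabla A.

Definition compact_cong (S : signature) (A : algebra S) (a : crel A) : Prop :=
  is_cong a /\
  forall F : crel A -> Prop, (forall th, F th -> is_cong th) ->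
    rle a (cbigjoin F) ->
    exists (n : nat) (g : 'I_n -> crel A), (forall i, F (g i)) /\
      rle a (cbigjoin (fun th => exists i, g i = th)).

Definition centralizes (S : signature) (A : algebra S) (a b d : crel A) : Prop :=
  forall (t : term S (nat + nat)) (x x' y y' : nat -> A),
    (forall i, a (x i) (x' i)) -> (forall i, b (y i) (y' i)) ->
    d (eval (fun v => match v with inl i => x i | inr j => y j end) t)
      (eval (fun v => match v with inl i => x i | inr j => y' j end) t) ->
    d (eval (fun v => match v with inl i => x' i | inr j => y j end) t)
      (eval (fun v => match v with inl i => x' i | inr j => y' j end) t).

Definition commutator (S : signature) (A : algebra S) (a b : crel A) : crel A :=
  fun x y => forall d, is_cong d -> centralizes a b d -> d x y.

Definition cong_modular_var (S : signature) (E : term S nat -> term S nat -> Prop) : Prop :=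
  forall B : algebra S, in_var E B ->
  forall a b c : crel B, is_cong a -> is_cong b -> is_cong c -> rle a c ->
    cjoin a (cmeet b c) = cmeet (cjoin a b) c.

(* no nontrivial algebra in V has a one-element subalgebra *)
Definition semidegenerate (S : signature) (E : term S nat -> term S nat -> Prop) : Prop :=
  forall B : algebra S, in_var E B ->
  forall e : B, (forall (o : op S), interp o (fun _ => e) = e) ->
  forall x y : B, x = y.

Definition compact_commutator_closed (S : signature)
  (E : term S nat -> term S nat -> Prop) : Prop :=
  forall B : algebra S, in_var E B ->
  forall a b : crel B, compact_cong a -> compact_cong b -> compact_cong (commutator a b).

Definition ubullet (S : signature) (A A' : algebra S) (u : A -> A') (a : crel A) : crel A' :=
  cgen (fun x' y' => exists x y, a x y /\ x' = u x /\ y' = u y).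

Definition lifts (S : signature) (A A' : algebra S) (u : A -> A')
  (Om' : crel A' -> Prop) (Om : crel A -> Prop) : Prop :=
  forall th', Om' th' <-> exists a, Om a /\ th' = ubullet u a.

Definition lifts_boolean (S : signature) (A A' : algebra S) (u : A -> A') : Prop :=
  lifts u (@boolean_cong S A') (@boolean_cong S A).

Definition orthogonal (S : signature) (A : algebra S) (Om : crel A -> Prop) : Prop :=
  forall a b, Om a -> Om b -> a <> b -> cmeet a b = @Delta A.

Definition countable_set (T : Type) (X : T -> Prop) : Prop :=
  exists f : nat -> T, forall x, X x -> exists n, f n = x.

(* Main.v *)
(** Semidegeneracy makes congruences distribute over a covering pair: if
    [a \/ b = Nabla] then [th = (th /\ a) \/ (th /\ b)].  Put
    [d = (th /\ a) \/ (th /\ b)], [a+ = a \/ (th /\ b)], [b+ = b \/ (th /\ a)];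
    modularity gives [a+ /\ th = b+ /\ th = d].  View [th] as a subalgebra of
    [A * A] and let [Psi] be the join on it of the restrictions of [a+ * a+] and
    [b+ * b+].  As [a \/ b = Nabla], [Psi] collapses the diagonal to a point, so
    the quotient has a one-element subalgebra and is trivial.  But the subset [d]
    of [th] is saturated for both relations, hence for [Psi], so [th = d].

    Now choose Boolean lifts [b_n] of the distinct members of [Om'], with
    complements [c_n], and put [g_n = b_n /\ c_0 /\ ... /\ c_(n-1)].  These are
    pairwise orthogonal.  Each factor [c_k] leaves the image under [ubullet u]
    unchanged: a piece [g <= b_n] is [(g /\ b_k) \/ (g /\ c_k)], and
    [g /\ b_k] has image below [ubullet u b_n /\ ubullet u b_k = Delta].  So only
    monotonicity and join preservation of [ubullet u] matter. *)

Require Import Defs.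
From mathcomp Require Import all_boot.
From Stdlib Require Import Classical ClassicalEpsilon FunctionalExtensionality.
From Stdlib Require Import PropExtensionality ProofIrrelevance Relation_Operators.

Set Implicit Arguments. Unset Strict Implicit. Unset Printing Implicit Defensive.

Lemma crel_eq (T : Type) (a b : crel T) : rle a b -> rle b a -> a = b.
Proof.
move=> ab ba; apply: functional_extensionality => x.
apply: functional_extensionality => y.
by apply: propositional_extensionality; split; [apply: ab | apply: ba].
Qed.

Lemma exist_eq (T : Type) (P : T -> Prop) (p q : {x | P x}) :
  sval p = sval q -> p = q.
Proof.
case: p => x px; case: q => y qy /= exy; subst y.
by rewrite (proof_irrelevance _ px qy).
Qed.

(** * Congruence lattices *)

Section Congruences.
Variables (S : signature) (A : algebra S).
Implicit Types (a b c th : crel A).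

Lemma cgen_cong (R : crel A) : is_cong (cgen R).
Proof.
split.
- by move=> x th [].
- by move=> x y H th cth Rth; have [_ s _ _] := cth; apply: s; apply: H.
- move=> x y z H1 H2 th cth Rth; have [_ _ t _] := cth.
  by apply: (t _ y); [apply: H1 | apply: H2].
- move=> o p q H th cth Rth; have [_ _ _ m] := cth.
  by apply: m => i; apply: H.
Qed.

Lemma sub_cgen (R : crel A) : rle R (cgen R).
Proof. by move=> x y Rxy th _; apply. Qed.

Lemma cgen_min (R : crel A) th : is_cong th -> rle R th -> rle (cgen R) th.
Proof. by move=> cth Rth x y; apply. Qed.

Lemma Delta_cong : is_cong (@Delta A).
Proof.
split=> //; first by move=> x y z ->.
by move=> o p q H; congr interp; apply: functional_extensionality.
Qed.

Lemma Nabla_cong : is_cong (@Nabla A).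
Proof. by []. Qed.

Lemma cmeet_cong a b : is_cong a -> is_cong b -> is_cong (cmeet a b).
Proof.
move=> [ra sa ta ma] [rb sb tb mb]; split=> //.
- by move=> x y [/sa ? /sb ?].
- by move=> x y z [a1 b1] [a2 b2]; split; [apply: ta a1 a2 | apply: tb b1 b2].
- by move=> o p q H; split; [apply: ma | apply: mb] => i; case: (H i).
Qed.

Lemma cjoin_cong a b : is_cong (cjoin a b).
Proof. exact: cgen_cong. Qed.

Lemma cjoin_l a b : rle a (cjoin a b).
Proof. by move=> x y H; apply: sub_cgen; left. Qed.

Lemma cjoin_r a b : rle b (cjoin a b).
Proof. by move=> x y H; apply: sub_cgen; right. Qed.

Lemma cjoin_min a b th : is_cong th -> rle a th -> rle b th -> rle (cjoin a b) th.
Proof. by move=> cth Ha Hb; apply: cgen_min => // x y [/Ha|/Hb]. Qed.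

Lemma cjoinC a b : cjoin a b = cjoin b a.
Proof.
by apply: crel_eq; apply: cjoin_min;
  (apply: cjoin_cong || apply: cjoin_l || apply: cjoin_r).
Qed.

Lemma cmeetC a b : cmeet a b = cmeet b a.
Proof. by apply: crel_eq => x y []. Qed.

Lemma is_cong_eq th x y : is_cong th -> x = y -> th x y.
Proof. by case=> r _ _ _ ->. Qed.

Definition compl_pair a b :=
  [/\ is_cong a, is_cong b, cmeet a b = @Delta A & cjoin a b = @Nabla A].

Lemma compl_pair_sym a b : compl_pair a b -> compl_pair b a.
Proof. by case=> ? ? ? ?; split=> //; [rewrite cmeetC | rewrite cjoinC]. Qed.

Lemma compl_pairP a : boolean_cong a <-> exists b, compl_pair a b.
Proof.
split; first by case=> ? [b [? [? ?]]]; exists b.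
by case=> b [? ? ? ?]; split=> //; exists b.
Qed.

Lemma Delta_compl_pair : compl_pair (@Delta A) (@Nabla A).
Proof.
split; [exact: Delta_cong | exact: Nabla_cong | |].
- by apply: crel_eq => x y // [].
- by apply: crel_eq => // x y ?; apply: cjoin_r.
Qed.

End Congruences.

(** * Equivalence closure of a union of congruences *)

Section UnionClosure.
Variables (S : signature) (A : algebra S) (al be : crel A).
Hypotheses (cal : is_cong al) (cbe : is_cong be).

Let U (x y : A) := al x y \/ be x y.
Let T := clos_refl_sym_trans A U.

Let upd n (c : 'I_n -> A) (i : 'I_n) (x : A) (j : 'I_n) := if j == i then x else c j.

Lemma union_closure_upd (o : op S) (c : 'I_(arity o) -> A) i x y :
  T x y -> T (interp o (upd c i x)) (interp o (upd c i y)).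
Proof.
elim=> {x y} [x y H | x | x y _ IH | x y z _ IH1 _ IH2].
- apply: rst_step; case: H => H; [left | right].
    have [r _ _ m] := cal; apply: m => j; rewrite /upd.
    by case: (j == i).
  have [r _ _ m] := cbe; apply: m => j; rewrite /upd.
  by case: (j == i).
- exact: rst_refl.
- exact: rst_sym.
- exact: rst_trans IH1 IH2.
Qed.

(** Operations are finitary, so their arguments can be exchanged one at a time, and each elementary
    step then stays inside [al] or inside [be]. Hence the join is described by finite chains. *)
Lemma union_closure_cong : is_cong T.
Proof.
split.
- by move=> x; apply: rst_refl.
- by move=> x y; apply: rst_sym.
- by move=> x y z; apply: rst_trans.
move=> o p q H.
(* Hybrid tuples lead from [p] to [q]: [h k] and [h k.+1] differ at most in coordinate [k], and
   agree once [k] reaches the arity. *)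
pose h k (i : 'I_(arity o)) := if (i < k)%N then q i else p i.
have step k : T (interp o p) (interp o (h k)).
  elim: k => [|k IH].
    by have -> : h 0 = p; [apply: functional_extensionality | apply: rst_refl].
  apply: (rst_trans _ _ _ _ _ IH).
  case: (ltnP k (arity o)) => [ltk|gek]; last first.
    have -> : h k.+1 = h k; last exact: rst_refl.
    apply: functional_extensionality => i; rewrite /h.
    by rewrite (leq_trans (ltn_ord i) gek) ltnS ltnW // (leq_trans (ltn_ord i) gek).
  pose ik := Ordinal ltk.
  have -> : h k = upd (h k) ik (p ik).
    apply: functional_extensionality => j; rewrite /upd; case: eqP => // ->.
    by rewrite /h ltnn.
  have -> : h k.+1 = upd (h k) ik (q ik).
    apply: functional_extensionality => j; rewrite /upd /h.
    case: eqP => [-> /=|nj]; first by rewrite ltnS leqnn.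
    rewrite ltnS leq_eqVlt; case: eqP => //= e.
    by case: nj; apply: val_inj.
  exact: union_closure_upd.
have e : h (arity o) = q by apply: functional_extensionality => i; rewrite /h ltn_ord.
by rewrite -e.
Qed.

End UnionClosure.

(** * Quotients and semidegeneracy *)

Section Quotient.
Variables (S : signature) (B : algebra S) (Psi : crel B).
Hypothesis cPsi : is_cong Psi.

(** The choice depends only on the predicate [Psi x], which related elements share, so each class
    gets a single representative. *)
Definition rep (x : B) : B := epsilon (inhabits x) (Psi x).

Lemma rep_rel x : Psi x (rep x).
Proof. by apply: epsilon_spec; exists x; case: cPsi. Qed.

Lemma rep_eq x y : Psi x y -> rep x = rep y.
Proof.
move=> Pxy; have [_ s t _] := cPsi; rewrite /rep.
have -> : Psi x = Psi y.
  apply: functional_extensionality => z; apply: propositional_extensionality.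
  by split=> H; [apply: (t _ x) => //; apply: s | apply: (t _ y)].
by rewrite (proof_irrelevance _ (inhabits x) (inhabits y)).
Qed.

Lemma rep_idem x : rep (rep x) = rep x.
Proof. by apply/esym/rep_eq/rep_rel. Qed.

(** Carried by the fixed points of [rep], so that equality in the quotient is plain equality. *)
Definition quot_algebra : algebra S :=
  @Algebra S {x : B | rep x = x}
    (fun o args => exist _ (rep (interp o (fun i => sval (args i)))) (rep_idem _)).

Lemma quot_eval (X : Type) (v : X -> quot_algebra) (t : term S X) :
  sval (eval v t) = rep (eval (fun x => sval (v x)) t).
Proof.
elim: t => [x|o ts IH] /=; first by rewrite (svalP (v x)).
apply: rep_eq; have [_ s _ m] := cPsi; apply: m => i; rewrite IH.
by apply: s; apply: rep_rel.
Qed.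

Lemma quot_in_var E : in_var E B -> in_var E quot_algebra.
Proof.
by move=> HB s t Est v; apply: exist_eq; rewrite !quot_eval (HB _ _ Est).
Qed.

Lemma semidegenerate_total E (e : B) : semidegenerate E -> in_var E B ->
  (forall o : op S, Psi (interp o (fun _ => e)) e) -> forall x y, Psi x y.
Proof.
move=> Hsemi HB He x y.
pose cls z : quot_algebra := exist _ (rep z) (rep_idem z).
have [_ s t m] := cPsi.
have exy : cls x = cls y.
  apply: (Hsemi _ (quot_in_var HB) (cls e)) => o.
  apply: exist_eq => /=; apply: rep_eq.
  apply: t (He o); apply: m => i; apply: s; exact: rep_rel.
have {}exy : rep x = rep y by case: exy.
by apply: (t _ (rep x)); [apply: rep_rel | rewrite exy; apply: s; apply: rep_rel].
Qed.

End Quotient.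

(** * A congruence as a subalgebra of the square *)

Section CongruenceAlgebra.
Variables (S : signature) (A : algebra S) (th : crel A).
Hypothesis cth : is_cong th.

Lemma cong_algebra_subproof (o : op S)
    (args : 'I_(arity o) -> {p : A * A | th p.1 p.2}) :
  th (interp o (fun i => (sval (args i)).1)) (interp o (fun i => (sval (args i)).2)).
Proof. by have [_ _ _ m] := cth; apply: m => i; apply: svalP (args i). Qed.

Definition cong_algebra : algebra S :=
  @Algebra S {p : A * A | th p.1 p.2}
    (fun o args =>
       exist (fun p : A * A => th p.1 p.2)
         (interp o (fun i => (sval (args i)).1), interp o (fun i => (sval (args i)).2))
         (cong_algebra_subproof args)).

Lemma cong_algebra_eval (X : Type) (v : X -> cong_algebra) (t : term S X) :
  sval (eval v t) =
  (eval (fun x => (sval (v x)).1) t, eval (fun x => (sval (v x)).2) t).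
Proof.
elim: t => [x|o ts IH] /=; first by case: (sval (v x)).
by congr pair; congr interp; apply: functional_extensionality => i; rewrite IH.
Qed.

Lemma cong_algebra_in_var E : in_var E A -> in_var E cong_algebra.
Proof.
move=> HA s t Est v; apply: exist_eq; rewrite !cong_algebra_eval.
by congr pair; apply: HA.
Qed.

Definition cong_square (a : crel A) : crel cong_algebra :=
  fun p q => a (sval p).1 (sval q).1 /\ a (sval p).2 (sval q).2.

Lemma cong_square_cong a : is_cong a -> is_cong (cong_square a).
Proof.
move=> [r s t m]; split.
- by move=> p; split.
- by move=> p q [? ?]; split; apply: s.
- by move=> p q w [p1 p2] [q1 q2]; split; [apply: t p1 q1 | apply: t p2 q2].
- by move=> o p q H; split; apply: m => i; case: (H i).
Qed.

Definition cong_diag (x : A) : cong_algebra :=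
  exist (fun p : A * A => th p.1 p.2) (x, x) (is_cong_eq cth (erefl x)).

Lemma cong_diag_hom (o : op S) (xs : 'I_(arity o) -> A) :
  cong_diag (interp o xs) = interp o (fun i => cong_diag (xs i)).
Proof. exact: exist_eq. Qed.

End CongruenceAlgebra.
Arguments cong_square {S A th} cth a.
Arguments cong_diag {S A th} cth x.

(** * Boolean congruences in a semidegenerate modular variety *)

Section Variety.
Variables (S : signature) (E : term S nat -> term S nat -> Prop).
Hypotheses (Hmod : cong_modular_var E) (Hsemi : semidegenerate E).
Variable A : algebra S.
Hypothesis HA : in_var E A.
Implicit Types a b c th : crel A.

(** The modular law for [cmeet th b], which lies below [th]. Exchanging [a] and [b] gives the bound
    for the other member of the covering pair. *)
Lemma modular_cap th a b : is_cong th -> is_cong a -> is_cong b ->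
  rle (cmeet (cjoin (cmeet th b) a) th) (cjoin (cmeet th a) (cmeet th b)).
Proof.
move=> cth ca cb x y.
rewrite -Hmod //; last by move=> ? ? [].
  by rewrite (cmeetC a) cjoinC.
exact: cmeet_cong.
Qed.

Lemma cover_decomp th a b : is_cong th -> is_cong a -> is_cong b ->
  cjoin a b = @Nabla A -> rle th (cjoin (cmeet th a) (cmeet th b)).
Proof.
move=> cth ca cb ab x y thxy.
set d := cjoin _ _.
have cd : is_cong d by apply: cjoin_cong.
pose ap := cjoin (cmeet th b) a; pose bp := cjoin (cmeet th a) b.
have cap : is_cong ap by apply: cjoin_cong.
have cbp : is_cong bp by apply: cjoin_cong.
have dap : rle d ap.
  by apply: cjoin_min => // z w H; [apply: cjoin_r; case: H | apply: cjoin_l].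
have dbp : rle d bp.
  by apply: cjoin_min => // z w H; [apply: cjoin_l | apply: cjoin_r; case: H].
have capd : rle (cmeet ap th) d by apply: modular_cap.
have cbpd : rle (cmeet bp th) d by rewrite /d cjoinC; apply: modular_cap.
pose al := cong_square cth ap; pose be := cong_square cth bp.
have cal : is_cong al by apply: cong_square_cong.
have cbe : is_cong be by apply: cong_square_cong.
(* The join is taken in its chain form, so that saturation can be proved by induction along
   chains. *)
pose Psi := clos_refl_sym_trans (cong_algebra cth) (fun p q => al p q \/ be p q).
have cPsi : is_cong Psi by apply: union_closure_cong.
(* Going from [q.1] to [p.1], [p.2] and [q.2] uses [e], [d <= e] and [e]; thus [q] lies in both [e]
   and [th], hence in [d]. *)
have saturated e p q : is_cong e -> rle d e -> rle (cmeet e th) d ->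
    cong_square cth e p q -> d (sval p).1 (sval p).2 -> d (sval q).1 (sval q).2.
  move=> [_ s t _] de ed [e1 e2] dp; apply: ed; split; last exact: svalP q.
  by apply: (t _ (sval p).1); [apply: s | apply: t e2; apply: de].
have Psi_saturated p q :
    Psi p q -> d (sval p).1 (sval p).2 <-> d (sval q).1 (sval q).2.
  elim=> {p q} [p q H | p | p q _ IH | p q r _ IH1 _ IH2] //;
    [| by split=> /IH | by split=> [/IH1/IH2|/IH2/IH1]].
  have [_ sal _ _] := cal; have [_ sbe _ _] := cbe.
  case: H => H; split.
  - exact: (saturated ap).
  - by apply: (saturated ap) => //; apply: sal.
  - exact: (saturated bp).
  - by apply: (saturated bp) => //; apply: sbe.
have diag z w : Psi (cong_diag cth z) (cong_diag cth w).
  have : cjoin a b z w by rewrite ab.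
  (* The pullback of [Psi] along the diagonal is a congruence above [a] and [b], hence total. *)
  pose P z' w' := Psi (cong_diag cth z') (cong_diag cth w').
  move: z w; apply: (@cjoin_min _ _ a b P).
  - have [r s t m] := cPsi; split.
    + by move=> z; apply: r.
    + by move=> z w; apply: s.
    + by move=> z w v; apply: t.
    + by move=> o p q H; rewrite /P !cong_diag_hom; apply: m.
  - by move=> z w H; apply: rst_step; left; split; apply: cjoin_r.
  - by move=> z w H; apply: rst_step; right; split; apply: cjoin_r.
pose p : cong_algebra cth := exist (fun p : A * A => th p.1 p.2) (x, y) thxy.
have Pp : Psi (cong_diag cth x) p.
  have HD := cong_algebra_in_var (cth := cth) HA.
  apply: (semidegenerate_total cPsi (e := cong_diag cth x) Hsemi HD) => o.
  by rewrite -cong_diag_hom; apply: diag.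
(* The pair [(x, x)] is in [d] by reflexivity; saturation carries this to [(x, y)]. *)
by have /= [H _] := Psi_saturated _ _ Pp; apply: H; case: cd.
Qed.

Lemma cmeet_compl_pair a b a' b' : compl_pair a b -> compl_pair a' b' ->
  compl_pair (cmeet a a') (cjoin b b').
Proof.
move=> [ca cb ab_meet ab_join] [ca' cb' ab_meet' ab_join'].
have cm := cmeet_cong ca ca'.
split; [exact: cm | exact: cjoin_cong | |]; apply: crel_eq.
- move=> x y [[ax a'x] H].
  (* Splitting [b'] along the cover [a], [b] leaves only its part below [a]; modularity then bounds
     the meet of [cjoin b b'] with [a] by [b']. *)
  have bb' : rle (cjoin b b') (cjoin (cmeet b' a) b).
    apply: cjoin_min; [exact: cjoin_cong | exact: cjoin_r |].
    move=> z w /(cover_decomp cb' ca cb ab_join).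
    apply: cjoin_min; [exact: cjoin_cong | exact: cjoin_l |].
    by move=> z' w' []; move=> _; apply: cjoin_r.
  have : cmeet (cjoin (cmeet b' a) b) a x y by split=> //; apply: bb'.
  rewrite -Hmod //; [|exact: cmeet_cong | by move=> ? ? []].
  rewrite (cmeetC b a) ab_meet => H'.
  have [b'x _] : cmeet b' a x y.
    move: H'; apply: cjoin_min => //; first exact: cmeet_cong.
    by move=> z w; apply: is_cong_eq; apply: cmeet_cong.
  by rewrite -ab_meet'.
- by move=> x y; apply: is_cong_eq; apply: cmeet_cong => //; apply: cjoin_cong.
- by [].
(* Splitting [a] along [a'], [b'] puts it below the new join, which already contains [b]. *)
- rewrite -ab_join; apply: cjoin_min; first exact: cjoin_cong.
    move=> x y /(cover_decomp ca ca' cb' ab_join').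
    apply: cjoin_min; [exact: cjoin_cong | exact: cjoin_l |].
    by move=> z w [_ H]; apply: cjoin_r; apply: cjoin_r.
  by move=> z w H; apply: cjoin_r; apply: cjoin_l.
Qed.

(** * Images of congruences under a morphism *)

Variables (A' : algebra S) (u : A -> A').
Hypothesis Hu : is_hom u.

Lemma ubullet_mono a b : rle a b -> rle (ubullet u a) (ubullet u b).
Proof.
move=> ab; apply: cgen_min; first exact: cgen_cong.
by move=> _ _ [x [y [H [-> ->]]]]; apply: sub_cgen; exists x, y; split=> //; apply: ab.
Qed.

Lemma ubullet_Delta : ubullet u (@Delta A) = @Delta A'.
Proof.
apply: crel_eq.
  by apply: cgen_min; [apply: Delta_cong | move=> _ _ [x [y [-> [-> ->]]]]].
by move=> x y; apply: is_cong_eq; apply: cgen_cong.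
Qed.

Lemma preim_cong (th : crel A') : is_cong th -> is_cong (fun x y => th (u x) (u y)).
Proof.
move=> [r s t m]; split.
- by move=> x; apply: r.
- by move=> x y; apply: s.
- by move=> x y z; apply: t.
- by move=> o p q H; rewrite !Hu; apply: m.
Qed.

Lemma ubullet_cut a b c : is_cong a -> compl_pair b c ->
  rle (ubullet u (cmeet a b)) (@Delta A') ->
  ubullet u (cmeet a c) = ubullet u a.
Proof.
move=> ca [cb cc _ bc] H; apply: crel_eq; first by apply: ubullet_mono => x y [].
have cu := cgen_cong (fun x' y' => exists x y, cmeet a c x y /\ x' = u x /\ y' = u y).
apply: cgen_min => // _ _ [x [y [axy [-> ->]]]].
move: x y axy (cover_decomp ca cb cc bc axy) => x0 y0 _; move: x0 y0.
(* Join preservation by adjunction: the preimage under [u] of the smaller image is a congruence, so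
   it suffices that it contains both pieces of [a]. *)
apply: (@cjoin_min _ _ _ _ (fun x y => ubullet u (cmeet a c) (u x) (u y))).
- exact: preim_cong.
- move=> x y abxy; apply: is_cong_eq => //; apply: H.
  by apply: sub_cgen; exists x, y.
- by move=> x y acxy; apply: sub_cgen; exists x, y.
Qed.

Lemma disjointify (b c : nat -> crel A) :
  (forall n, compl_pair (b n) (c n)) ->
  (forall m n, (m < n)%N ->
     cmeet (ubullet u (b n)) (ubullet u (b m)) = @Delta A') ->
  exists g : nat -> crel A,
    [/\ forall n, boolean_cong (g n),
        forall m n, (m < n)%N -> cmeet (g m) (g n) = @Delta A &
        forall n, ubullet u (g n) = ubullet u (b n)].
Proof.
move=> Hbc Hd.
pose g n k := iteri k (fun i x => cmeet x (c i)) (b n).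
have g_bool n k : exists g', compl_pair (g n k) g'.
  elim: k => [|k [g' IH]]; first by exists (c n); apply: Hbc.
  exists (cjoin g' (b k)).
  exact: (cmeet_compl_pair IH (compl_pair_sym (Hbc k))).
have g_le n k : rle (g n k) (b n).
  by elim: k => [|k IH] //= x y [/IH].
have g_c n k m : (m < k)%N -> rle (g n k) (c m).
  elim: k => [|k IH] //; rewrite ltnS leq_eqVlt => /orP[/eqP->|/IH H] x y [] //.
  by move=> /H.
have cong_g n k : is_cong (g n k) by have [g' []] := g_bool n k.
exists (fun n => g n n); split.
- by move=> n; apply/compl_pairP.
- move=> m n ltmn; apply: crel_eq.
    move=> x y [/g_le bx /(g_c _ _ _ ltmn) cx].
    by have [_ _ <- _] := Hbc m.
  by move=> x y; apply: is_cong_eq; apply: cmeet_cong.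
(* Only the number of factors becomes [k]; the bound [k <= n] stays because cutting by [c k] is
   harmless only for [k < n]. *)
move=> n; have: (n <= n)%N by []; move: {1 4}n => k.
elim: k => [|k IH] //= ltkn.
rewrite -IH; last exact: ltnW.
apply: ubullet_cut (Hbc k) _ => // x y H.
rewrite -(Hd k n ltkn); split; apply: ubullet_mono H => z w [] //.
by move=> /g_le.
Qed.

End Variety.

(** * Removing repetitions and assembling the lift *)

Lemma first_index (T : Type) (f : nat -> T) (n : nat) :
  exists2 k, f k = f n & forall m, (m < k)%N -> f m <> f k.
Proof.
elim/ltn_ind: n => n IH.
case: (classic (exists2 m, (m < n)%N & f m = f n)) => [[m ltmn e]|H].
  by rewrite -e; apply: IH.
by exists n => // m ltmn e; apply: H; exists m.
Qed.

Theorem theorem7p1 (S : signature) (E : term S nat -> term S nat -> Prop)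
  (HfinS : finite_signature S)
  (Hmod : cong_modular_var E)
  (Hsemi : semidegenerate E)
  (Hcomp : compact_commutator_closed E)
  (A A' : algebra S) (HA : in_var E A) (HA' : in_var E A')
  (u : A -> A') (Hu : is_hom u) (Hlift : lifts_boolean u)
  (Om' : crel A' -> Prop)
  (HOm'B : forall th, Om' th -> boolean_cong th)
  (HOm'o : orthogonal Om') (HOm'c : countable_set Om') :
  exists Om : crel A -> Prop,
    (forall a, Om a -> boolean_cong a) /\ orthogonal Om /\ countable_set Om /\
    lifts u Om' Om.
Proof.
have [f Hf] := HOm'c.
(* The enumeration may leave [Om'] or repeat itself. Keeping first occurrences makes distinct valid
   indices carry distinct congruences, as orthogonality requires. *)
pose valid n := Om' (f n) /\ forall m, (m < n)%N -> f m <> f n.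
(* Redundant indices get the lift [Delta], so that all pairs are disjoint. *)
have lift n : exists bc : crel A * crel A, compl_pair bc.1 bc.2 /\
    (valid n /\ ubullet u bc.1 = f n \/ ~ valid n /\ bc.1 = @Delta A).
  case: (classic (valid n)) => [vn|nvn]; last first.
    by exists (@Delta A, @Nabla A); split; [apply: Delta_compl_pair | right].
  have [a [/compl_pairP[c Hac] e]] := (Hlift (f n)).1 (HOm'B _ (proj1 vn)).
  by exists (a, c); split=> //; left.
have [bc Hbc] : exists bc : nat -> crel A * crel A, forall n,
    compl_pair (bc n).1 (bc n).2 /\
    (valid n /\ ubullet u (bc n).1 = f n \/ ~ valid n /\ (bc n).1 = @Delta A).
  exists (fun n => sval (constructive_indefinite_description _ (lift n))) => n.
  exact: svalP (constructive_indefinite_description _ (lift n)).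
have meetD (a : crel A') : is_cong a -> cmeet a (@Delta A') = @Delta A'.
  by move=> ca; apply: crel_eq => x y; [case | move=> e; split=> //; apply: is_cong_eq].
have disj m n : (m < n)%N ->
    cmeet (ubullet u (bc n).1) (ubullet u (bc m).1) = @Delta A'.
  move=> ltmn; have [_ [[vm em]|[_ ->]]] := Hbc m; last first.
    by rewrite ubullet_Delta meetD //; apply: cgen_cong.
  have [_ [[vn en]|[_ ->]]] := Hbc n; last first.
    by rewrite ubullet_Delta cmeetC meetD //; apply: cgen_cong.
  rewrite em en; apply: HOm'o; [by case: vn | by case: vm |].
  by move=> e; case: vn => _ /(_ m ltmn); apply.
have [g [g_bool g_orth g_lift]] := disjointify Hmod Hsemi HA Hu
  (fun n => proj1 (Hbc n)) disj.
have g_valid n : valid n -> ubullet u (g n) = f n.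
  by move=> vn; rewrite g_lift; have [_ [[]|[]]] := Hbc n.
(* Redundant indices are dropped: their image is [Delta], which need not belong to [Om']. *)
exists (fun a => exists2 n, valid n & a = g n).
split; last split; last split; last (move=> th'; split).
- by move=> _ [n _ ->].
- move=> _ _ [n _ ->] [m _ ->] ne.
  case: (ltngtP n m) => [lt|lt|e]; [exact: g_orth | |].
    by rewrite cmeetC; apply: g_orth.
  by case: ne; rewrite e.
- by exists g => _ [n _ ->]; exists n.
- move=> Hth'; have [n en] := Hf _ Hth'.
  have [k ek kmin] := first_index f n.
  have vk : valid k by split=> //; rewrite ek en.
  by exists (g k); split; [exists k | rewrite g_valid // ek].
- by move=> [_ [[n vn ->] ->]]; rewrite g_valid //; case: vn.
Qed.
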